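(* Let $k\ge 2$, $s\ge 2$, $n\ge 1$ be integers. Let $H$ be the graph with vertex set $\{u_i,v_i:1\le i\le 2k\}\cup\{x_{i,j}:1\le i\le k,\ 1\le j\le 2n\}$ and edges $u_iv_i$ ($1\le i\le 2k$) and $u_ix_{i,j}, v_ix_{i,j}, u_{2k+1-i}x_{i,j}, v_{2k+1-i}x_{i,j}$ ($1\le i\le k$, $1\le j\le 2n$), so $H\cong k(2P_2\vee O_{2n})$. Suppose $\{v_1,\dots,v_{2k}\}$ is partitioned into blocks each of size $s$ such that no two vertices in the same block have a common neighbor in $H$, and let $G$ be obtained from $H$ by identifying all vertices of each block into a single vertex (whose neighborhood is the union of their neighborhoods). Then $\chi_{la}(G)=3$.
   Context: For a graph $G$ with $q$ edges, a local antimagic labeling is a bijection $f:E(G)\to\{1,\dots,q\}$ such that, writing $f^+(u)=\sum_{e\ni u}f(e)$, we have $f^+(u)\ne f^+(v)$ for every edge $uv$. $\chi_{la}(G)$ is the minimum over all local antimagic labelings of the number of distinct values of $f^+$. $aP_2$ is a disjoint union of $a$ one-edge paths, $O_m$ the edgeless graph on $m$ vertices, $\vee$ the join, $kH$ the disjoint union of $k$ copies of $H$. The family of all such graphs $G$ is denoted $\mathcal J_1(k,2n,s)$ in the paper. *)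

(* Defs.v *)
From mathcomp Require Import all_boot.

Set Implicit Arguments.
Unset Strict Implicit.
Unset Printing Implicit Defensive.

Record sgraph := SGraph {
  svertex :> finType;
  adj : rel svertex;
  adj_sym : symmetric adj;
  adj_irr : irreflexive adj }.
Arguments adj {s} x y.

Definition edges (G : sgraph) : {set {set G}} :=
  [set [set p.1; p.2] | p : G * G & adj p.1 p.2].

(* A labeling is a function on all sets of vertices; only its values on the
   edges of G are ever used. *)
Definition vertex_sum (G : sgraph) (f : {set G} -> nat) (u : G) : nat :=
  \sum_(a in edges G | u \in a) f a.

Definition local_antimagic (G : sgraph) (f : {set G} -> nat) : Prop :=
  [/\ {in edges G &, injective f},
      forall a, a \in edges G -> 1 <= f a <= #|edges G|,
      forall m, 1 <= m <= #|edges G| -> exists2 a, a \in edges G & f a = m &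
      forall u v : G, adj u v -> vertex_sum f u != vertex_sum f v].

Definition num_colors (G : sgraph) (f : {set G} -> nat) : nat :=
  size (undup (codom (vertex_sum f))).

(* [chi_la_is G m] says that chi_la(G) exists and equals m; it fails for every
   m when G has no local antimagic labeling. *)
Definition chi_la_is (G : sgraph) (m : nat) : Prop :=
  (exists2 f : {set G} -> nat, local_antimagic f & num_colors f = m) /\
  (forall f : {set G} -> nat, local_antimagic f -> m <= num_colors f).

(* Identification of the vertices of each block of P, where P is a partition of
   some set of vertices of G: the new vertices are the blocks of P together
   with the singletons of the vertices not covered by P. *)
Section Identify.
Variables (G : sgraph) (P : {set {set G}}).

Definition classes : {set {set G}} :=
  P :|: [set [set x] | x in ~: cover P].

Definition identify_vertex : finType := {B : {set G} | B \in classes}.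

Definition identify_adj : rel identify_vertex := fun B C =>
  (B != C) && [exists x in val B, exists y in val C, adj x y].

Lemma identify_adj_sym : symmetric identify_adj.
Proof.
move=> B C; rewrite /identify_adj eq_sym; congr (_ && _).
by apply/exists_inP/exists_inP => -[x xB /exists_inP[y yC xy]];
   exists y => //; apply/exists_inP; exists x => //; rewrite adj_sym.
Qed.

Lemma identify_adj_irr : irreflexive identify_adj.
Proof. by move=> B; rewrite /identify_adj eqxx. Qed.

Definition identify : sgraph := SGraph identify_adj_sym identify_adj_irr.

End Identify.

(* Vertices of H. Indices start at 0, so the index 2k+1-i becomes 2k-1-i. *)
Definition H_vertex (k n : nat) : finType :=
  ('I_(2 * k) + 'I_(2 * k) + 'I_k * 'I_(2 * n))%type.

Definition u_ (k n : nat) (i : 'I_(2 * k)) : H_vertex k n := inl (inl i).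
Definition v_ (k n : nat) (i : 'I_(2 * k)) : H_vertex k n := inl (inr i).
Definition x_ (k n : nat) (i : 'I_k) (j : 'I_(2 * n)) : H_vertex k n :=
  inr (i, j).

Definition H_arc (k n : nat) (a b : H_vertex k n) : bool :=
  match a, b with
  | inl (inl i), inl (inr i') => i == i'
  | inl (inl i), inr (i', _) | inl (inr i), inr (i', _) =>
      (i == i' :> nat) || (i == 2 * k - 1 - i' :> nat)
  | _, _ => false
  end.

Definition H_adj (k n : nat) : rel (H_vertex k n) :=
  fun a b => H_arc a b || H_arc b a.

Lemma H_adj_sym (k n : nat) : symmetric (@H_adj k n).
Proof. by move=> a b; rewrite /H_adj orbC. Qed.

Lemma H_adj_irr (k n : nat) : irreflexive (@H_adj k n).
Proof. by case=> [[i|i]|[i j]]. Qed.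

Definition H (k n : nat) : sgraph := SGraph (@H_adj_sym k n) (@H_adj_irr k n).

Definition v_set (k n : nat) : {set H k n} :=
  [set v_ n i | i in [set: 'I_(2 * k)]].

(* Main.v *)
(** Every edge [u_i v_i] lies in a triangle, so at least three colors are needed.
    For the converse it suffices to label [H] so that all [u_i] have the same
    sum [U], all [v_i] the same sum [V] and all [x_(i,j)] the same sum [X], with
    [U], [s V] and [X] distinct: since no two identified vertices have a common
    neighbor, identification is bijective on edges and adds up vertex sums.

    Put [M = 2k] and cut the labels into consecutive blocks of length [M], numbered
    from 0. Block 0 goes to the edges [u_i v_i], increasingly in [i]. For every [j]
    but the last one, the edges [u_i x_j] and [v_i x_j] get the complementary blocks
    [j] and [4n+1-j], both increasing in [i] or both decreasing, alternately. The
    last [j] gets the two middle blocks, traversed with slope [-2]. The slopes then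
    add up to [1 + 1 - 2 = 0] at [u_i] and at [v_i], and labels affine in [i] have a
    constant sum over the two rows [i] and [2k+1-i] that meet at [x_(i,j)]. *)
Require Import Defs.
From mathcomp Require Import all_boot.
From mathcomp Require Import zify.

Set Implicit Arguments.
Unset Strict Implicit.
Unset Printing Implicit Defensive.

(** * Labelings of an identified graph, obtained from labelings of oriented edges *)

Section OrientedIdentification.

Variables (G : sgraph) (arc : rel G) (P : {set {set G}}) (D : {set G}).
Hypothesis adjE : forall a b : G, adj a b = arc a b || arc b a.
Hypothesis arc_asym : forall a b : G, arc a b -> ~~ arc b a.
Hypothesis partP : partition P D.
Hypothesis stableD : forall a b : G, a \in D -> b \in D -> ~~ adj a b.
Hypothesis no_common_nbr : forall (B : {set G}) (a b : G), B \in P ->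
  a \in B -> b \in B -> a <> b -> ~ exists z : G, adj a z /\ adj b z.

Let coverP : cover P = D. Proof. exact: cover_partition partP. Qed.
Let trivP : trivIset P. Proof. by case/and3P: partP. Qed.

(** [pblock P z] is empty off the cover of [P], so uncovered vertices get their singleton
    separately. *)
Definition block_of (z : G) : {set G} :=
  if z \in cover P then pblock P z else [set z].

Lemma block_of_class z : block_of z \in classes P.
Proof.
rewrite /block_of /classes inE; case: ifPn => zP; first by rewrite pblock_mem.
by rewrite imset_f ?orbT // inE.
Qed.

Definition class_of (z : G) : identify P :=
  exist (fun B => B \in classes P) _ (block_of_class z).

Lemma mem_class_of z : z \in val (class_of z).
Proof.
by rewrite /= /block_of; case: ifP => zP; rewrite ?mem_pblock ?inE.
Qed.

Lemma mem_classE z (w : identify P) : (z \in val w) = (class_of z == w).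
Proof.
apply/idP/eqP => [zw|<-]; last exact: mem_class_of.
apply: val_inj => /=; rewrite /block_of.
have := valP w; rewrite /classes inE => /orP[wP|/imsetP[x xP wx]].
  have zP : z \in cover P by apply/bigcupP; exists (val w).
  by rewrite zP; apply: def_pblock.
by move: zw xP; rewrite wx !inE => /eqP-> /negbTE->.
Qed.

Lemma class_of_val (w : identify P) : exists z, w = class_of z.
Proof.
have : exists z, z \in val w.
  have := valP w; rewrite /classes inE => /orP[wP|/imsetP[x _ ->]].
    by apply/set0Pn; apply: contraTneq wP => ->; case/and3P: partP.
  by exists x; rewrite inE.
by case=> z; rewrite mem_classE => /eqP<-; exists z.
Qed.

Lemma class_of_eq a b : class_of a = class_of b -> a != b ->
  [/\ a \in D, b \in D & exists2 B, B \in P & (a \in B) && (b \in B)].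
Proof.
move=> eq_ab ne_ab; have := mem_class_of a; rewrite eq_ab /= /block_of coverP.
case: ifPn => bD; last by rewrite inE (negbTE ne_ab).
move=> aB; have BP : pblock P b \in P by rewrite pblock_mem ?coverP.
split=> //; first by rewrite -coverP; apply/bigcupP; exists (pblock P b).
by exists (pblock P b); rewrite // aB mem_pblock coverP.
Qed.

Lemma class_of_adj a b : adj a b -> class_of a != class_of b.
Proof.
move=> ab; apply/eqP => eq_ab; have [eqab|neab] := eqVneq a b.
  by rewrite eqab adj_irr in ab.
have [aD bD _] := class_of_eq eq_ab neab.
by rewrite (negbTE (stableD aD bD)) in ab.
Qed.

(** If [a] and [a'] were distinct, they would share a block inside [D]. Their neighbors [b] and [b']
    lie outside the independent set [D], so having the same class they coincide, and [b] is a
    forbidden common neighbor. *)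
Lemma class_of_edge_inj a b a' b' : adj a b -> adj a' b' ->
  class_of a = class_of a' -> class_of b = class_of b' -> a = a' /\ b = b'.
Proof.
have key x y x' y' : adj x y -> adj x' y' -> class_of x = class_of x' ->
    class_of y = class_of y' -> x = x'.
  move=> xy xy' eqx eqy; apply/eqP/negPn/negP => nex.
  have [xD x'D [B BP /andP[xB x'B]]] := class_of_eq eqx nex.
  apply: (no_common_nbr BP xB x'B); first exact/eqP.
  exists y; split => //; have [->//|ney] := eqVneq y y'.
  have [yD _ _] := class_of_eq eqy ney.
  by rewrite (negbTE (stableD xD yD)) in xy.
move=> ab ab' eqa eqb; split; first exact: key ab ab' eqa eqb.
by apply: (key b a b' a'); rewrite // adj_sym.
Qed.

Definition arcs : {set G * G} := [set p | arc p.1 p.2].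

Definition arc_edge (p : G * G) : {set identify P} :=
  [set class_of p.1; class_of p.2].

Lemma arc_edge_inj : {in arcs &, injective arc_edge}.
Proof.
move=> [a b] [a' b'] /[!inE] /= ab ab' eqE.
have adjab : adj a b by rewrite adjE ab.
have adjab' : adj a' b' by rewrite adjE ab'.
have adjba' : adj b' a' by rewrite adj_sym.
have neab := class_of_adj adjab; have neab' := class_of_adj adjab'.
have : class_of a \in arc_edge (a', b') by rewrite -eqE !inE eqxx.
have : class_of b \in arc_edge (a', b') by rewrite -eqE !inE eqxx orbT.
rewrite !inE /= => /orP[] /eqP eqb /orP[] /eqP eqa.
- by rewrite eqa eqb eqxx in neab.
(* The endpoints match crosswise: this would make both [(a, b)] and its reverse arcs. *)
- have [ea eb] := class_of_edge_inj adjab adjba' eqa eqb.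
  by move: (arc_asym ab); rewrite ea eb ab'.
- by have [-> ->] := class_of_edge_inj adjab adjab' eqa eqb.
- by rewrite eqa eqb eqxx in neab.
Qed.

Lemma identify_adj_class_of a b :
  adj a b -> adj (class_of a) (class_of b).
Proof.
move=> ab; rewrite /adj /= /identify_adj class_of_adj //=.
apply/exists_inP; exists a; first exact: mem_class_of.
by apply/exists_inP; exists b => //; exact: mem_class_of.
Qed.

Lemma identify_adj_inv (w w' : identify P) : adj w w' ->
  exists a b, [/\ adj a b, w = class_of a & w' = class_of b].
Proof.
case/andP=> _ /exists_inP[a aw /exists_inP[b bw ab]].
exists a, b; split=> //; apply/esym/eqP; first by rewrite -mem_classE.
by rewrite -mem_classE.
Qed.

Lemma edges_identify : edges (identify P) = arc_edge @: arcs.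
Proof.
apply/setP => S; apply/imsetP/imsetP =>
  [[[w w'] /[!inE] ww' ->]|[[a b] ab ->]].
  have [a [b [ab -> ->]]] := identify_adj_inv ww'.
  move: ab; rewrite adjE => /orP[ab|ba]; first by exists (a, b); rewrite ?inE.
  by exists (b, a); rewrite ?inE // /arc_edge setUC.
rewrite inE in ab; exists (class_of a, class_of b); rewrite ?inE //.
by apply: identify_adj_class_of; rewrite adjE ab.
Qed.

Lemma card_edges_identify : #|edges (identify P)| = #|arcs|.
Proof. by rewrite edges_identify (card_in_imset arc_edge_inj). Qed.

Variable L : G -> G -> nat.

(** The sum inverts [arc_edge]: it has exactly one term when [S] is an edge and is 0 otherwise. *)
Definition push_label (S : {set identify P}) : nat :=
  \sum_(p in arcs | arc_edge p == S) L p.1 p.2.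

Lemma push_labelE p : p \in arcs -> push_label (arc_edge p) = L p.1 p.2.
Proof.
move=> pA; apply: (big_pred1 p) => p' /=.
apply/andP/eqP => [[p'A /eqP]|->]; first exact: arc_edge_inj.
by rewrite eqxx.
Qed.

Definition arc_sum (z : G) : nat :=
  \sum_(y | arc z y) L z y + \sum_(y | arc y z) L y z.

(** An edge at [w] comes from an arc with exactly one end in [w], since adjacent vertices lie in
    different classes. The sum thus splits by whether this end is the tail or the head. *)
Lemma vertex_sum_push (w : identify P) :
  vertex_sum push_label w = \sum_(z in val w) arc_sum z.
Proof.
rewrite /vertex_sum edges_identify.
rewrite (big_imset_cond _ _ _ arc_edge_inj).
transitivity (\sum_(p in arcs | (class_of p.1 == w) || (class_of p.2 == w))
    L p.1 p.2).
  apply: eq_big => [p|p /andP[pA _]]; last exact: push_labelE.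
  by rewrite !inE ![w == _]eq_sym.
rewrite (bigID (fun p => class_of p.1 == w)) /= big_split /=; congr (_ + _).
  rewrite pair_big_dep /=; apply: eq_bigl => p; rewrite mem_classE !inE.
  by case: (_ == w); rewrite ?andbF ?andbT.
(* Swapping the pair makes the head the outer index, as in the second sum of [arc_sum]. *)
rewrite pair_big_dep /= (reindex_inj (h := fun p => (p.2, p.1))) /=; last first.
  by move=> [a b] [c d] [-> ->].
apply: eq_bigl => -[a b]; rewrite mem_classE !inE /=.
have [ba|_] := boolP (arc b a); last by rewrite !andbF.
have [aw|_] := boolP (class_of a == w); rewrite ?orbF ?orbT ?andbN //=.
rewrite -(eqP aw); by apply: class_of_adj; rewrite adjE ba.
Qed.

Section LocalAntimagic.

Variables (q : nat) (col : G -> nat).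
Hypothesis card_arcs : #|arcs| = q.
Hypothesis L_onto :
  forall m, 1 <= m <= q -> exists2 p, p \in arcs & L p.1 p.2 = m.
Hypothesis sum_col :
  forall z, \sum_(y in block_of z) arc_sum y = col z.
Hypothesis col_proper : forall a b, arc a b -> col a != col b.

Lemma vertex_sum_col z : vertex_sum push_label (class_of z) = col z.
Proof. by rewrite vertex_sum_push -sum_col. Qed.

Lemma push_label_antimagic : local_antimagic push_label.
Proof.
have onto m : 1 <= m <= q ->
    exists2 a, a \in edges (identify P) & push_label a = m.
  case/L_onto=> p pA <-; exists (arc_edge p); last exact: push_labelE.
  by rewrite edges_identify imset_f.
have card_eq : #|edges (identify P)| = q by rewrite card_edges_identify.
(* Pigeonhole: [q] labels that cover [1, ..., q] are pairwise distinct and take no other value. *)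
pose s := [seq push_label a | a <- enum (edges (identify P))].
have sub_s : {subset iota 1 q <= s}.
  move=> m; rewrite mem_iota add1n ltnS => /onto[a aE <-].
  by apply: map_f; rewrite mem_enum.
have size_s : size s <= size (iota 1 q) by rewrite size_map -cardE size_iota card_eq.
rewrite /local_antimagic card_eq; split=> //.
- apply/dinjectiveP; rewrite /dinjectiveb.
  exact: leq_size_uniq (iota_uniq 1 q) sub_s size_s.
- move=> a aE; have [_ eq_s] := uniq_min_size (iota_uniq 1 q) sub_s size_s.
  have : push_label a \in iota 1 q by rewrite eq_s map_f ?mem_enum.
  by rewrite mem_iota add1n ltnS.
- move=> w w' /identify_adj_inv[a [b [ab -> ->]]]; rewrite !vertex_sum_col.
  by move: ab; rewrite adjE => /orP[/col_proper|/col_proper]; rewrite // eq_sym.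
Qed.

Lemma num_colors_push (cs : seq nat) : uniq cs ->
  (forall z, col z \in cs) -> {in cs, forall c, exists z, col z = c} ->
  num_colors push_label = size cs.
Proof.
move=> uniq_cs sub_cs onto_cs; apply/perm_size/uniq_perm => // [|c].
  exact: undup_uniq.
rewrite mem_undup; apply/codomP/idP => [[w ->]|/onto_cs[z <-]].
  by have [z ->] := class_of_val w; rewrite vertex_sum_col.
by exists (class_of z); rewrite vertex_sum_col.
Qed.

End LocalAntimagic.

End OrientedIdentification.

Lemma local_antimagic_triangle (G : sgraph) (f : {set G} -> nat) (a b c : G) :
  adj a b -> adj a c -> adj b c -> local_antimagic f -> 3 <= num_colors f.
Proof.
move=> ab ac bc [_ _ _ proper].
apply: (@uniq_leq_size _ [seq vertex_sum f z | z <- [:: a; b; c]]).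
  by rewrite /= !inE negb_or !proper.
by move=> m /mapP[z _ ->]; rewrite mem_undup codom_f.
Qed.

(** * Arithmetic of the labels: row sums, sums of mated rows, surjectivity, distinct colors *)

Section Labels.

Variables (M n : nat).

(** Offset in [1, ..., M] inside a block; two consecutive values of [j] contribute [M.+1] together,
    whatever [i] is. *)
Definition zigzag (i j : nat) : nat := if odd j then M - i else i.+1.

(** As [j] starts at 0, the block is [j.+1]. In the last column the [u] rows take the odd offsets of
    the two merged middle blocks, the [v] rows the even ones. *)
Definition ux_label (i j : nat) : nat :=
  if j.+1 == 2 * n then 2 * n * M + 2 * (M - i) - 1
  else j.+1 * M + zigzag i j.

Definition vx_label (i j : nat) : nat :=
  if j.+1 == 2 * n then 2 * n * M + 2 * (M - i)
  else (4 * n - j) * M + zigzag i j.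

(* The common vertex sums [U], [V] and [X] in closed form. *)
Definition u_color : nat := 2 * n * n * M + 2 * n * M + M + n.
Definition v_color : nat := 6 * n * n * M + 2 * n * M + n + 1.
Definition x_color : nat := (8 * n + 4) * M + 2.

(** The ordinary columns are odd in number. Induction adds them in pairs, each free of [i]; the
    unpaired one leaves [i.+1], which the edge [u_i v_i] and the last column later cancel. *)
Lemma sum_ux_blocks (i m : nat) : i < M ->
  \sum_(0 <= j < m.*2.+1) (j.+1 * M + zigzag i j) =
  m.*2.+1 * m.+1 * M + m * M.+1 + i.+1.
Proof.
move=> ltiM; elim: m => [|m IHm].
  by rewrite big_nat_recr //= big_geq // /zigzag /=; lia.
rewrite doubleS big_nat_recr //= big_nat_recr //= IHm /zigzag /= odd_double /=.
by move/subnKC: ltiM; nia.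
Qed.

Lemma sum_vx_blocks (i m : nat) : m < n -> i < M ->
  \sum_(0 <= j < m.*2.+1) ((4 * n - j) * M + zigzag i j) =
  m.*2.+1 * (4 * n - m) * M + m * M.+1 + i.+1.
Proof.
move=> ltmn ltiM; elim: m ltmn => [|m IHm] ltmn.
  by rewrite big_nat_recr //= big_geq // /zigzag /=; lia.
rewrite doubleS big_nat_recr //= big_nat_recr //= IHm 1?ltnW //.
rewrite /zigzag /= odd_double /=.
(* Writing [n] and [M] as sums removes the truncated subtractions and leaves a polynomial
   identity. *)
have [p ->] : exists p, n = p + m.+2 by exists (n - m.+2); lia.
have [r ->] : exists r, M = r + i.+1 by exists (M - i.+1); lia.
have -> : 4 * (p + m.+2) - m = 4 * p + 3 * m + 8 by lia.
have -> : 4 * (p + m.+2) - m.*2.+1 = 4 * p + 2 * m + 7 by lia.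
have -> : 4 * (p + m.+2) - m.*2.+2 = 4 * p + 2 * m + 6 by lia.
have -> : 4 * (p + m.+2) - m.+1 = 4 * p + 3 * m + 7 by lia.
have -> : r + i.+1 - i = r.+1 by lia.
by rewrite -!mul2n; lia.
Qed.

Lemma sum_ux_label (i : nat) : 0 < n -> i < M ->
  i.+1 + \sum_(j < 2 * n) ux_label i j = u_color.
Proof.
rewrite /u_color -(big_mkord xpredT (ux_label i)) => n_gt0 ltiM.
have n2E : 2 * n = (n.-1).*2.+2 by lia.
rewrite n2E big_nat_recr //= -n2E {2}/ux_label -n2E eqxx.
rewrite (eq_big_nat _ _ (F2 := fun j => j.+1 * M + zigzag i j)); last first.
  by move=> j /= ltj; rewrite /ux_label ifN //; lia.
rewrite sum_ux_blocks //; case: n n_gt0 {n2E} => // m _ /=.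
have [r ->] : exists r, M = r + i.+1 by exists (M - i.+1); lia.
by rewrite -!mul2n; nia.
Qed.

Lemma sum_vx_label (i : nat) : 0 < n -> i < M ->
  i.+1 + \sum_(j < 2 * n) vx_label i j = v_color.
Proof.
rewrite /v_color -(big_mkord xpredT (vx_label i)) => n_gt0 ltiM.
have n2E : 2 * n = (n.-1).*2.+2 by lia.
rewrite n2E big_nat_recr //= -n2E {2}/vx_label -n2E eqxx.
rewrite (eq_big_nat _ _ (F2 := fun j => (4 * n - j) * M + zigzag i j));
  last first.
  by move=> j /= ltj; rewrite /vx_label ifN //; lia.
rewrite sum_vx_blocks ?prednK //; case: n n_gt0 {n2E} => // m _ /=.
have -> : 4 * m.+1 - m = 3 * m + 4 by lia.
have [r ->] : exists r, M = r + i.+1 by exists (M - i.+1); lia.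
by rewrite -!mul2n; nia.
Qed.

(** In an ordinary column the two block numbers add up to [4 * n + 1] and mated offsets to [M + 1],
    each counted twice. In the last column the four offsets add up to [4 * M + 2]. *)
Lemma mate_labels (i j : nat) : i < M -> j < 2 * n ->
  ux_label i j + vx_label i j
  + (ux_label (M - 1 - i) j + vx_label (M - 1 - i) j) = x_color.
Proof.
rewrite /ux_label /vx_label /x_color /zigzag => ltiM ltj.
have [r ->] : exists r, M = r + i.+1 by exists (M - i.+1); lia.
have [jE|_] := eqVneq; first by nia.
have [p pE] : exists p, 4 * n = j + p by exists (4 * n - j); lia.
have -> : 4 * n - j = p by lia.
have -> : 8 * n + 4 = 2 * (j + p) + 4 by lia.
by case: (odd j); nia.
Qed.

Lemma label_onto (m : nat) : 0 < n -> 1 <= m <= M * (4 * n + 1) ->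
  exists2 i, i < M &
    [\/ m = i.+1, exists2 j, j < 2 * n & m = ux_label i j
     | exists2 j, j < 2 * n & m = vx_label i j].
Proof.
move=> n_gt0 /andP[m_gt0 lem]; have M_gt0 : 0 < M by case: (M) lem => //; lia.
(* Labels start at 1, so [m.-1] is divided: [t] is the block and [r.+1] the offset. *)
have mE := divn_eq m.-1 M; have ltr := ltn_pmod m.-1 M_gt0.
move: (m.-1 %/ M) (m.-1 %% M) mE ltr => t r mE ltrM.
have let4n : t < 4 * n + 1 by nia.
have zigzag_onto j : exists2 i, i < M & zigzag i j = r.+1.
  rewrite /zigzag; case: (odd j); last by exists r.
  by exists (M - r.+1); lia.
case: (posnP t) => [t0|t_gt0]; first by exists r => //; constructor 1; lia.
have [ltt|let2n] := ltnP t (2 * n).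
  have [i ltiM iE] := zigzag_onto t.-1; exists i => //; constructor 2.
  exists t.-1; first lia.
  by rewrite /ux_label ifN ?iE ?prednK //; lia.
have [ltt|let2] := ltnP t (2 * n + 2).
  pose d := m.-1 - 2 * n * M.
  have dE : m = 2 * n * M + d.+1 by rewrite /d; nia.
  have ltd : d < 2 * M by nia.
  (* This row solves [2 * (M - i) = d.+1] for odd [d] and [2 * (M - i) - 1 = d.+1] for even [d]. *)
  exists (M - (d./2).+1); first lia.
  have [oddd|evend] := boolP (odd d); [constructor 3 | constructor 2];
    exists (2 * n).-1; rewrite /ux_label /vx_label ?prednK ?eqxx; lia.
have [i ltiM iE] := zigzag_onto (4 * n - t); exists i => //; constructor 3.
exists (4 * n - t); first lia.
rewrite /vx_label ifN ?iE; last lia.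
have -> : 4 * n - (4 * n - t) = t by lia.
lia.
Qed.

Lemma colors_uniq (s : nat) : 2 <= s -> 4 <= M -> 0 < n ->
  uniq [:: u_color; s * v_color; x_color].
Proof.
move=> hs hM hn; rewrite /= !inE negb_or andbT /u_color /v_color /x_color.
apply/andP; split; [apply/andP; split|].
- by rewrite neq_ltn; apply/orP; left; nia.
(* The order of the two colors changes: [u_color] exceeds [x_color] for [n] at least 4 and is below
   it for [n] at most 3. *)
- have [lt4n|] := ltnP 3 n; first by rewrite neq_ltn; apply/orP; right; nia.
  by case: n hn => [|[|[|[]]]] // _ _; lia.
- rewrite neq_ltn; apply/orP; right.
  set V := (X in s * X); have : 2 * V <= s * V.
    by rewrite leq_mul2r hs orbT.
  by rewrite /V; nia.
Qed.

End Labels.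

(** * The labeling on [H]: arc sums, edge count, colors after identification *)

Section JoinGraph.

Variables (k n : nat).

Definition H_label (a b : H k n) : nat :=
  match a, b with
  | inl (inl i), inl (inr _) => i.+1
  | inl (inl i), inr (_, j) => ux_label (2 * k) n i j
  | inl (inr i), inr (_, j) => vx_label (2 * k) n i j
  | _, _ => 0
  end.

(** Exactly one of [i] and its mate [2 * k - 1 - i] is below [k]; it is the index of the
    component. *)
Lemma component_of (i : 'I_(2 * k)) : exists c : 'I_k,
  forall c' : 'I_k, (i == c' :> nat) || (i == 2 * k - 1 - c' :> nat) = (c' == c).
Proof.
have ltiM := ltn_ord i.
have ltc : (if i < k then i : nat else 2 * k - 1 - i) < k by case: ifP; lia.
exists (Ordinal ltc) => c'; have ltc' := ltn_ord c'.
rewrite -val_eqE /= {ltc}; case: ifP; lia.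
Qed.

Lemma sum_component (i : 'I_(2 * k)) (F : 'I_k * 'I_(2 * n) -> nat) (g : nat -> nat) :
  (forall p, F p = g p.2) ->
  \sum_(p : 'I_k * 'I_(2 * n) |
     let: (c, _) := p in (i == c :> nat) || (i == 2 * k - 1 - c :> nat)) F p
  = \sum_(j < 2 * n) g j.
Proof.
move=> FE; have [c cE] := component_of i.
transitivity (\sum_(p : 'I_k * 'I_(2 * n) | (p.1 == c) && true) g p.2).
  by apply: eq_big => [[c' j]|p _] //; rewrite cE andbT.
by rewrite -(pair_big_dep (pred1 c) (fun _ _ => true) (fun _ (j : 'I_(2 * n)) => g j))
           big_pred1_eq.
Qed.

Lemma sum_mates (c : 'I_k) (g : nat -> nat) :
  \sum_(i < 2 * k | (i == c :> nat) || (i == 2 * k - 1 - c :> nat)) g i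
  = g c + g (2 * k - 1 - c).
Proof.
have ltc := ltn_ord c.
have lt1 : c < 2 * k by lia.
have lt2 : 2 * k - 1 - c < 2 * k by lia.
rewrite (bigD1 (Ordinal lt1)) ?eqxx //=; congr (_ + _).
rewrite (big_pred1 (Ordinal lt2)) // => i /=; rewrite -!val_eqE /=; lia.
Qed.

Definition H_sum (z : H k n) : nat :=
  match z with
  | inl (inl _) => u_color (2 * k) n
  | inl (inr _) => v_color (2 * k) n
  | inr _ => x_color (2 * k) n
  end.

Lemma arc_sum_H (z : H k n) : 0 < n ->
  arc_sum (@H_arc k n : rel (H k n)) H_label z = H_sum z.
Proof.
move=> n_gt0; rewrite /arc_sum !big_sumType /=.
case: z => [[i|i]|[c j]] /=.
- rewrite !big_pred0_eq (big_pred1 i) //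
          (sum_component _ (g := ux_label (2 * k) n i)).
    by rewrite add0n !addn0 sum_ux_label.
  by case.
- rewrite !big_pred0_eq (big_pred1 i) //
          (sum_component _ (g := vx_label (2 * k) n i)).
    by rewrite !add0n !addn0 addnC sum_vx_label.
  by case.
- rewrite !big_pred0_eq addn0 (sum_mates c (fun i => ux_label (2 * k) n i j)).
  rewrite (sum_mates c (fun i => vx_label (2 * k) n i j)) addnACA add0n.
  have ltc := ltn_ord c.
  by rewrite -(@mate_labels _ _ c j) ?ltn_ord //; lia.
Qed.

Lemma card_arcs_H :
  #|arcs (@H_arc k n : rel (H k n))| = 2 * k * (4 * n + 1).
Proof.
rewrite -sum1_card.
transitivity (\sum_(a : H k n) \sum_(b : H k n | H_arc a b) 1).
  by rewrite pair_big_dep; apply: eq_bigl => p; rewrite inE.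
rewrite big_sumType big_sumType /=.
have comp (i : 'I_(2 * k)) :=
  sum_component i (F := fun=> 1) (g := fun=> 1) (fun _ => erefl).
(* Out-degrees are [2 * n + 1] at each [u_i], [2 * n] at each [v_i], and 0 at each [x_(c,j)]. *)
rewrite (eq_bigr (fun=> 2 * n + 1)) => [|i _]; last first.
  rewrite !big_sumType /= big_pred0_eq (big_pred1 i) // comp.
  by rewrite sum1_card card_ord add0n addnC.
rewrite [X in _ + X + _](eq_bigr (fun=> 2 * n)) => [|i _]; last first.
  rewrite !big_sumType /= !big_pred0_eq comp.
  by rewrite sum1_card card_ord add0n.
rewrite [X in _ + X](eq_bigr (fun=> 0)) => [|c _]; last first.
  by rewrite !big_sumType /= !big_pred0_eq.
rewrite !sum_nat_const !card_ord; lia.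
Qed.

Lemma H_label_onto (m : nat) : 0 < n -> 1 <= m <= 2 * k * (4 * n + 1) ->
  exists2 p, p \in arcs (@H_arc k n : rel (H k n)) & H_label p.1 p.2 = m.
Proof.
move=> n_gt0 /(label_onto n_gt0)[i lti].
pose i' := Ordinal lti; have [c cE] := component_of i'.
have arcE := cE c; rewrite eqxx in arcE.
case=> [->|[j ltj ->]|[j ltj ->]].
- by exists (u_ n i', v_ n i'); rewrite ?inE //=.
- by exists (u_ n i', x_ c (Ordinal ltj)); rewrite ?inE.
- by exists (v_ n i', x_ c (Ordinal ltj)); rewrite ?inE.
Qed.

Lemma in_v_set (z : H k n) :
  (z \in v_set k n) = if z is inl (inr _) then true else false.
Proof.
apply/imsetP/idP => [[i _ ->] //|]; case: z => [[|i]|] // _.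
by exists i.
Qed.

Lemma v_set_stable (a b : H k n) :
  a \in v_set k n -> b \in v_set k n -> ~~ adj a b.
Proof. by rewrite !in_v_set; case: a => [[]|] //; case: b => [[]|]. Qed.

Lemma H_arc_asym (a b : H k n) : H_arc a b -> ~~ H_arc b a.
Proof. by case: a => [[]|[]] ?; case: b => [[]|[]]. Qed.

Definition H_color (s : nat) (z : H k n) : nat :=
  if z is inl (inr _) then s * v_color (2 * k) n else H_sum z.

(** A block consists of [s] vertices [v_i], all of sum [v_color]; every other class is a
    singleton. *)
Lemma sum_block_of (s : nat) (P : {set {set H k n}}) (z : H k n) : 0 < n ->
  partition P (v_set k n) -> (forall B : {set H k n}, B \in P -> #|B| = s) ->
  \sum_(y in block_of P z) arc_sum (@H_arc k n : rel (H k n)) H_label y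
  = H_color s z.
Proof.
move=> n_gt0 partP cardP.
under eq_bigr do rewrite arc_sum_H //.
rewrite /block_of (cover_partition partP) in_v_set /H_color.
case: z => [[i|i]|[c j]]; rewrite ?big_set1 //.
have iP : v_ n i \in cover P by rewrite (cover_partition partP) in_v_set.
have BP := pblock_mem iP; rewrite -/(v_ n i).
rewrite (eq_bigr (fun=> v_color (2 * k) n)) => [|y yB].
  by rewrite sum_nat_const cardP.
have : y \in cover P by apply/bigcupP; exists (pblock P (v_ n i)).
by rewrite (cover_partition partP) in_v_set; case: y {yB} => [[]|].
Qed.

Lemma H_color_proper (s : nat) (a b : H k n) :
  uniq [:: u_color (2 * k) n; s * v_color (2 * k) n; x_color (2 * k) n] ->
  H_arc a b -> H_color s a != H_color s b.
Proof.
rewrite /= !inE negb_or andbT => /andP[/andP[uv ux] vx].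
by case: a => [[]|[]] ?; case: b => [[]|[]].
Qed.

End JoinGraph.

Theorem theorem2p11 (k s n : nat) (hk : 2 <= k) (hs : 2 <= s) (hn : 1 <= n)
    (P : {set {set H k n}})
    (hP : partition P (v_set k n))
    (hsize : forall B : {set H k n}, B \in P -> #|B| = s)
    (hnbr : forall (B : {set H k n}) (a b : H k n), B \in P ->
       a \in B -> b \in B -> a <> b ->
       ~ exists z : H k n, adj a z /\ adj b z) :
  chi_la_is (identify P) 3.
Proof.
pose arc : rel (H k n) := @H_arc k n.
have adjE (a b : H k n) : adj a b = arc a b || arc b a by [].
have k_gt0 : 0 < k by lia.
have k2_gt0 : 0 < 2 * k by lia.
have n2_gt0 : 0 < 2 * n by lia.
(* The triangle [u_i v_i x_(c,j)] with [i = j = 0] survives identification, which gives the lower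
   bound; its vertices also witness the three colors. *)
pose i := Ordinal k2_gt0; pose j := Ordinal n2_gt0.
have [c cE] := component_of i; have arc_ic := cE c; rewrite eqxx in arc_ic.
have ux : adj (u_ n i : H k n) (x_ c j) by rewrite adjE /arc /= arc_ic.
have vx : adj (v_ n i : H k n) (x_ c j) by rewrite adjE /arc /= arc_ic.
have uv : adj (u_ n i : H k n) (v_ n i) by rewrite adjE /arc /= ?eqxx.
have colors := @colors_uniq (2 * k) n s hs ltac:(lia) hn.
have sum_col z := sum_block_of z hn hP hsize.
split; last first.
  move=> f; apply: local_antimagic_triangle;
    apply: (identify_adj_class_of hP (@v_set_stable k n));
    [exact: uv | exact: ux | exact: vx].
exists (push_label arc (H_label (k := k) (n := n)) (P := P)).
  apply: (push_label_antimagic adjE (@H_arc_asym k n) hP (@v_set_stable k n) hnbr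
           (card_arcs_H k n) _ sum_col).
    by move=> m; apply: H_label_onto.
  by move=> a b; apply: H_color_proper.
apply: (num_colors_push adjE (@H_arc_asym k n) hP (@v_set_stable k n) hnbr
         sum_col colors).
  by case=> [[]|[]] *; rewrite !inE eqxx ?orbT.
move=> _ /[!inE] /or3P[] /eqP->.
- by exists (u_ n i).
- by exists (v_ n i).
- by exists (x_ c j).
Qed.
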